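(* Let $K$ be an arbitrary field. The conditions (1) $(V_1,G_1)\sim_{at}(V_2,G_2)$ and (2) $G_1\sim G_2$ on two group representations over $K$ do not imply $(V_1,G_1)\sim(V_2,G_2)$. That is, for every field $K$ there exist representations $(V_1,G_1),(V_2,G_2)\in REP\text{-}K$ such that $(V_1,G_1)$ and $(V_2,G_2)$ are action type geometrically equivalent, the groups $G_1$ and $G_2$ are geometrically equivalent, and $(V_1,G_1)$ and $(V_2,G_2)$ are not geometrically equivalent.
   Context: Fix a field $K$. A representation is a pair $(V,G)$, where $V$ is a $K$-vector space and $G$ is a group acting linearly on $V$ on the right; the action is written $(v,g)\mapsto v\circ g$. It is viewed as a 2-sorted algebra. $REP\text{-}K$ denotes the variety of all such representations. A homomorphism $(\alpha,\beta):(V,G)\to(W,H)$ consists of a $K$-linear map $\alpha:V\to W$ and a group homomorphism $\beta:G\to H$ with $\alpha(v\circ g)=\alpha(v)\circ\beta(g)$ for all $v\in V$, $g\in G$. For finite sets $X,Y$, let $F(Y)$ be the free group on $Y$, $KF(Y)$ its group algebra over $K$, and $XKF(Y)=\bigoplus_{x\in X}xKF(Y)$ the free right $KF(Y)$-module with basis $X$. The free representation generated by $X$ and $Y$ is $(XKF(Y),F(Y))$, with $F(Y)$ acting by right multiplication. Geometrical equivalence of representations. For $T_1\subseteq XKF(Y)$ and $T_2\subseteq F(Y)$, let $$(T_1,T_2)'_{(V,G)}=\{(\alpha,\beta)\in\mathrm{Hom}((XKF(Y),F(Y)),(V,G)) : T_1\subseteq\ker\alpha,\ T_2\subseteq\ker\beta\},$$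 $$(T_1,T_2)''_{(V,G)}=\Big(\bigcap_{(\alpha,\beta)\in(T_1,T_2)'_{(V,G)}}\ker\alpha,\ \bigcap_{(\alpha,\beta)\in(T_1,T_2)'_{(V,G)}}\ker\beta\Big).$$ $(V_1,G_1)$ and $(V_2,G_2)$ are geometrically equivalent, written $(V_1,G_1)\sim(V_2,G_2)$, if $(T_1,T_2)''_{(V_1,G_1)}=(T_1,T_2)''_{(V_2,G_2)}$ for all finite sets $X,Y$ and all $T_1\subseteq XKF(Y)$, $T_2\subseteq F(Y)$. Action type geometrical equivalence. For $T\subseteq XKF(Y)$, let $$T'_{(V,G)}=\{(\alpha,\beta)\in\mathrm{Hom}((XKF(Y),F(Y)),(V,G)) : T\subseteq\ker\alpha\},\qquad T'^{\triangledown}_{(V,G)}=\bigcap_{(\alpha,\beta)\in T'_{(V,G)}}\ker\alpha\subseteq XKF(Y).$$ $(V_1,G_1)$ and $(V_2,G_2)$ are action type geometrically equivalent, written $(V_1,G_1)\sim_{at}(V_2,G_2)$, if $T'^{\triangledown}_{(V_1,G_1)}=T'^{\triangledown}_{(V_2,G_2)}$ for all finite sets $X,Y$ and all $T\subseteq XKF(Y)$. Geometrical equivalence of groups. For a group $G$, a finite set $Y$ and $T\subseteq F(Y)$, let $T''_G=\bigcap\{\ker\beta : \beta\in\mathrm{Hom}(F(Y),G),\ T\subseteq\ker\beta\}$. Groups $G_1,G_2$ are geometrically equivalent, written $G_1\sim G_2$, if $T''_{G_1}=T''_{G_2}$ for all finite $Y$ and all $T\subseteq F(Y)$. *)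

(* Defs.v *)
From HB Require Import structures.
From mathcomp Require Import all_boot all_algebra.
From mathcomp Require Import finmap.
From mathcomp.multinomials Require Import monalg.
From mathcomp Require Import boolp classical_sets.

Set Implicit Arguments.
Unset Strict Implicit.
Unset Printing Implicit Defensive.

Import GRing.Theory.

Local Open Scope ring_scope.
Local Open Scope classical_set_scope.

(* [free_group Y] is the group of reduced words in the letters [(y, false)]
   (standing for [y]) and [(y, true)] (standing for [y^-1]); the product of
   two reduced words is the reduction of their concatenation. *)

Section FreeGroup.
Variable Y : choiceType.

Definition letter_inv (a : Y * bool) : Y * bool := (a.1, ~~ a.2).

Definition reduced (w : seq (Y * bool)) : bool :=
  sorted (fun a b => b != letter_inv a) w.

(* Left multiplication of a reduced word by a letter. *)
Definition word_push (a : Y * bool) (w : seq (Y * bool)) : seq (Y * bool) :=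
  if w is b :: w' then if b == letter_inv a then w' else a :: w else [:: a].

Definition word_mul (u v : seq (Y * bool)) : seq (Y * bool) :=
  foldr word_push v u.

Definition word_inv (w : seq (Y * bool)) : seq (Y * bool) :=
  rev (map letter_inv w).

Record free_group : predArgType := FreeGroup {
  word_of :> seq (Y * bool);
  _ : reduced word_of }.

HB.instance Definition _ := [isSub for word_of].
HB.instance Definition _ := [Choice of free_group by <:].

Lemma letter_invK : involutive letter_inv.
Proof. by case=> y b; rewrite /letter_inv /= negbK. Qed.

Lemma reduced_behead a w : reduced (a :: w) -> reduced w.
Proof. exact: path_sorted. Qed.

Lemma word_push_reduced a w : reduced w -> reduced (word_push a w).
Proof.
case: w => [|b w] //= rw; case: ifPn => [_|ne].
  exact: reduced_behead rw.
by rewrite /= ne.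
Qed.

Lemma word_mul_reduced u v : reduced v -> reduced (word_mul u v).
Proof. by move=> rv; elim: u => //= a u IH; apply: word_push_reduced. Qed.

Lemma word_pushK a w : reduced w ->
  word_push a (word_push (letter_inv a) w) = w.
Proof.
case: w => [|b w] /=; first by rewrite eqxx.
rewrite letter_invK => rw; case: ifPn => [/eqP eba|_] /=; last by rewrite eqxx.
rewrite {}eba in rw *.
by case: w rw => [|c w] //; rewrite /reduced /= => /andP[/negPf -> _].
Qed.

Lemma word_mul_push a u w : reduced w ->
  word_mul (word_push a u) w = word_push a (word_mul u w).
Proof.
move=> rw; case: u => [|b u] //=; case: ifPn => [/eqP ->|] //=.
by rewrite word_pushK // word_mul_reduced.
Qed.

Lemma word_mulA u v w : reduced w ->
  word_mul u (word_mul v w) = word_mul (word_mul u v) w.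
Proof. by move=> rw; elim: u => //= a u ->; rewrite word_mul_push. Qed.

Lemma word_mul0 u : reduced u -> word_mul u [::] = u.
Proof.
elim: u => //= a u IH ru; rewrite IH ?(reduced_behead ru) //.
by case: u ru {IH} => [|b u] //; rewrite /reduced /= => /andP[/negPf ->].
Qed.

Lemma word_inv_reduced w : reduced w -> reduced (word_inv w).
Proof.
rewrite /reduced /word_inv rev_sorted sorted_map.
apply: sub_sorted => a b /=; apply: contra.
by rewrite letter_invK eq_sym.
Qed.

Lemma word_mul_cat u v w : word_mul (u ++ v) w = word_mul u (word_mul v w).
Proof. exact: foldr_cat. Qed.

Lemma word_mulKV w v : reduced v -> word_mul w (word_mul (word_inv w) v) = v.
Proof.
move=> rv; elim: w v rv => //= a w IH v rv.
rewrite /word_inv /= rev_cons -cats1 word_mul_cat -/(word_inv w) /= IH.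
  exact: word_pushK.
exact: word_push_reduced.
Qed.

Lemma word_invK : involutive word_inv.
Proof.
by move=> w; rewrite /word_inv map_rev revK mapK //; apply: letter_invK.
Qed.

Definition fg_one : free_group := @FreeGroup [::] isT.

Definition fg_mul (u v : free_group) : free_group :=
  FreeGroup (word_mul_reduced u (valP v)).

Definition fg_inv (u : free_group) : free_group :=
  FreeGroup (word_inv_reduced (valP u)).

Definition fg_gen (y : Y) : free_group := @FreeGroup [:: (y, false)] isT.

Fact fg_mulA : associative fg_mul.
Proof. by move=> u v w; apply/val_inj; apply: word_mulA; apply: valP. Qed.

Fact fg_mul1 : left_id fg_one fg_mul.
Proof. by move=> u; apply/val_inj. Qed.

Fact fg_mulr1 : right_id fg_one fg_mul.
Proof. by move=> u; apply/val_inj; apply: word_mul0; apply: valP. Qed.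

Fact fg_mulV : right_inverse fg_one fg_inv fg_mul.
Proof.
move=> u; apply/val_inj => /=.
rewrite -[X in word_mul _ X]word_mul0 ?word_mulKV //.
exact: word_inv_reduced (valP u).
Qed.

Fact fg_mulVl : left_inverse fg_one fg_inv fg_mul.
Proof.
move=> u; rewrite -[u in X in fg_mul _ X = _](_ : fg_inv (fg_inv u) = u).
  exact: fg_mulV.
by apply/val_inj => /=; rewrite word_invK.
Qed.

HB.instance Definition _ :=
  isGroup.Build free_group fg_mulA fg_mul1 fg_mulr1 fg_mulVl fg_mulV.

End FreeGroup.

Section FreeGroupUniversal.
Local Open Scope group_scope.
Variables (Y : choiceType) (G : groupType).

Lemma free_group_lift (f : Y -> G) :
  exists h : {multiplicative free_group Y -> G}, forall y, h (fg_gen y) = f y.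
Proof.
pose ev1 (a : Y * bool) : G := if a.2 then (f a.1)^-1 else f a.1.
pose ev (w : seq (Y * bool)) : G := foldr (fun a g => ev1 a * g) 1 w.
have ev1V a : ev1 (letter_inv a) = (ev1 a)^-1.
  by case: a => y []; rewrite /ev1 /= ?invgK.
have evP a w : ev (word_push a w) = ev1 a * ev w.
  case: w => [|b w] //=; case: ifPn => [/eqP ->|] //=.
  by rewrite ev1V mulVKg.
have evM : {morph (fun u : free_group Y => ev u) : u v / u * v}.
  move=> u v /=; elim: (word_of u) => [|a w IH] /=; first by rewrite mul1g.
  by rewrite evP IH mulgA.
pose h := monoid.isMultiplicative.Build _ _ _ evM.
exists (HB.pack_for {multiplicative free_group Y -> G}
          (fun u : free_group Y => ev u) h) => y /=.
by rewrite /ev /= /ev1 /= mulg1.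
Qed.

Lemma free_group_ext (h1 h2 : {multiplicative free_group Y -> G}) :
  (forall y, h1 (fg_gen y) = h2 (fg_gen y)) -> h1 =1 h2.
Proof.
move=> h12; have h1E (h : {multiplicative free_group Y -> G}) : h 1 = 1.
  by apply: (mulgI (h 1)); rewrite -gmulfM !mulg1.
have hV (h : {multiplicative free_group Y -> G}) u : h u^-1 = (h u)^-1.
  by apply: (mulgI (h u)); rewrite -gmulfM !mulgV h1E.
have letterE (a : Y * bool) (ra : reduced [:: a]) :
    h1 (FreeGroup ra) = h2 (FreeGroup ra).
  case: a ra => y [] ra.
    have -> : FreeGroup ra = (fg_gen y)^-1 by apply/val_inj.
    by rewrite !hV h12.
  by have -> : FreeGroup ra = fg_gen y by apply/val_inj.
case=> w; elim: w => [|a w IH] rw.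
  by have -> : FreeGroup rw = 1 by [apply/val_inj]; rewrite !h1E.
have ra : reduced [:: a] by [].
have -> : FreeGroup rw = FreeGroup ra * FreeGroup (reduced_behead rw).
  apply/val_inj => /=; case: w rw {IH} => [|b w] //; rewrite /reduced /=.
  by case/andP=> /negPf ->.
by rewrite !gmulfM letterE IH.
Qed.

End FreeGroupUniversal.

Definition group_algebra (K : fieldType) (G : groupType) := {malg K[G]}.

HB.instance Definition _ (K : fieldType) (G : groupType) :=
  GRing.Lmodule.on (group_algebra K G).

(* Convolution: [(sum_g a_g g) (sum_h b_h h) = sum_(g, h) (a_g b_h) (g h)].
   It is locked because unification otherwise unfolds it at great cost. *)
HB.lock Definition ga_mul (K : fieldType) (G : groupType)
    (a b : group_algebra K G) : group_algebra K G :=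
  \sum_(g <- msupp a) \sum_(h <- msupp b) << a@_g * b@_h *g (g * h)%g >>.

Section GroupAlgebra.
Variables (K : fieldType) (G : groupType).
Local Notation ga_mul := (@ga_mul K G).
Implicit Types (a b c : group_algebra K G) (g h : G) (k : K).

Definition ga_of (g : G) : group_algebra K G := << g >>.

Lemma ga_mulw (d1 d2 : {fset G}) a b :
  (msupp a `<=` d1)%fset -> (msupp b `<=` d2)%fset ->
  ga_mul a b = \sum_(g <- d1) \sum_(h <- d2) << a@_g * b@_h *g (g * h)%g >>.
Proof.
move=> le1 le2; rewrite ga_mul.unlock (big_fset_incl _ le1) /=.
  apply/eq_bigr=> g _; apply/big_fset_incl => // h _ /mcoeff_outdom ->.
  by rewrite mulr0 monalgU0.
move=> g _ /mcoeff_outdom ag.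
by rewrite big1 // => h _; rewrite ag mul0r monalgU0.
Qed.

Lemma ga_mulDl : left_distributive ga_mul +%R.
Proof.
move=> a b c; have s := fsubset_refl (msupp c).
rewrite (ga_mulw (msuppD_le a b) s) (ga_mulw (fsubsetUl _ (msupp b)) s).
rewrite (ga_mulw (fsubsetUr (msupp a) _) s) -big_split /=.
apply/eq_bigr=> g _; rewrite -big_split /=; apply/eq_bigr=> h _.
by rewrite mcoeffD mulrDl monalgUD.
Qed.

Lemma ga_mulDr : right_distributive ga_mul +%R.
Proof.
move=> c a b; have s := fsubset_refl (msupp c).
rewrite (ga_mulw s (msuppD_le a b)) (ga_mulw s (fsubsetUl _ (msupp b))).
rewrite (ga_mulw s (fsubsetUr (msupp a) _)) -big_split /=.
apply/eq_bigr=> g _; rewrite -big_split /=; apply/eq_bigr=> h _.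
by rewrite mcoeffD mulrDr monalgUD.
Qed.

Lemma ga_mul0l : left_zero 0 ga_mul.
Proof. by move=> a; rewrite ga_mul.unlock msupp0 big_seq_fset0. Qed.

Lemma ga_mul0r : right_zero 0 ga_mul.
Proof.
by move=> a; rewrite ga_mul.unlock big1 // => g _; rewrite msupp0 big_seq_fset0.
Qed.

Lemma ga_mulUU (k l : K) g h :
  ga_mul << k *g g >> << l *g h >> = << k * l *g (g * h)%g >>.
Proof. by rewrite (ga_mulw msuppU_le msuppU_le) !big_seq_fset1 !mcoeffUU. Qed.

Lemma ga_mul_suml I (r : seq I) (F : I -> group_algebra K G) b :
  ga_mul (\sum_(i <- r) F i) b = \sum_(i <- r) ga_mul (F i) b.
Proof.
exact: (big_morph (ga_mul^~ b) (fun x y => ga_mulDl x y b) (ga_mul0l b)).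
Qed.

Lemma ga_mul_sumr I (r : seq I) (F : I -> group_algebra K G) a :
  ga_mul a (\sum_(i <- r) F i) = \sum_(i <- r) ga_mul a (F i).
Proof. exact: (big_morph (ga_mul a) (ga_mulDr a) (ga_mul0r a)). Qed.

Lemma ga_mulA : associative ga_mul.
Proof.
move=> a b c; rewrite [a]monalgE (ga_mul_suml _ _ (ga_mul b c)).
rewrite (ga_mul_suml _ _ b) (ga_mul_suml _ _ c); apply: eq_bigr => g _.
rewrite [b]monalgE (ga_mul_suml _ _ c) !(ga_mul_sumr _ _ << _ *g g >>).
rewrite (ga_mul_suml _ _ c); apply: eq_bigr => h _.
rewrite [c]monalgE (ga_mul_sumr _ _ << _ *g h >>) !ga_mul_sumr.
apply: eq_bigr => l _.
by rewrite !ga_mulUU mulrA mulgA.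
Qed.

Lemma ga_mul1 : left_id (ga_of 1%g) ga_mul.
Proof.
move=> a; rewrite [a]monalgE ga_mul_sumr; apply: eq_bigr => g _.
by rewrite ga_mulUU mul1r mul1g.
Qed.

Lemma ga_mulr1 : right_id (ga_of 1%g) ga_mul.
Proof.
move=> a; rewrite [a]monalgE ga_mul_suml; apply: eq_bigr => g _.
by rewrite ga_mulUU mulr1 mulg1.
Qed.

Lemma ga_one_neq0 : ga_of 1%g != 0.
Proof. by rewrite monalgU_eq0 oner_eq0. Qed.

HB.instance Definition _ := GRing.Zmodule_isNzRing.Build (group_algebra K G)
  ga_mulA ga_mul1 ga_mulr1 ga_mulDl ga_mulDr ga_one_neq0.

Lemma scale_monalgU (k l : K) g :
  k *: (<< l *g g >> : group_algebra K G) = << k * l *g g >>.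
Proof. by apply/malgP => h; rewrite mcoeffZ !mcoeffU mulrnAr. Qed.

Lemma ga_scalel k a : k *: a = ga_mul << k *g 1%g >> a.
Proof.
rewrite [a]monalgE ga_mul_sumr scaler_sumr; apply: eq_bigr => g _.
by rewrite scale_monalgU ga_mulUU mul1g.
Qed.

Lemma ga_scaler k a : k *: a = ga_mul a << k *g 1%g >>.
Proof.
rewrite [a]monalgE ga_mul_suml scaler_sumr; apply: eq_bigr => g _.
by rewrite scale_monalgU ga_mulUU mulg1 mulrC.
Qed.

Lemma ga_scaleAl k a b : k *: (a * b) = (k *: a) * b.
Proof. by rewrite !ga_scalel; apply: ga_mulA. Qed.

Lemma ga_scaleAr k a b : k *: (a * b) = a * (k *: b).
Proof. by rewrite !ga_scaler; apply/esym/ga_mulA. Qed.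

HB.instance Definition _ :=
  GRing.Lmodule_isLalgebra.Build K (group_algebra K G) ga_scaleAl.
HB.instance Definition _ :=
  GRing.Lalgebra_isAlgebra.Build K (group_algebra K G) ga_scaleAr.

Lemma ga_ofM g h : ga_of (g * h)%g = ga_of g * ga_of h.
Proof. by rewrite [RHS]ga_mulUU mulr1. Qed.

End GroupAlgebra.

Record representation (K : fieldType) := Representation {
  rep_space :> lmodType K;
  rep_group : groupType;
  rep_act : rep_space -> rep_group -> rep_space;
  rep_act_linear : forall g, linear (fun v => rep_act v g);
  rep_act1 : forall v, rep_act v 1%g = v;
  rep_actM : forall v g h, rep_act v (g * h)%g = rep_act (rep_act v g) h }.

Record rep_hom (K : fieldType) (R S : representation K) := RepHom {
  hom_space : {linear R -> S};
  hom_group : {multiplicative rep_group R -> rep_group S};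
  hom_act : forall v g,
    hom_space (rep_act v g) = rep_act (hom_space v) (hom_group g) }.

Section FreeRepresentation.
Variables (K : fieldType) (X Y : finType).

(* The free right [K F(Y)]-module with basis [X]: as [X] is finite, it is the
   module of all functions [X -> K F(Y)]. *)
Definition free_module := {ffun X -> group_algebra K (free_group Y)}.

Definition free_module_mulr (v : free_module)
    (a : group_algebra K (free_group Y)) : free_module :=
  [ffun x => v x * a].

Definition free_act (v : free_module) (w : free_group Y) : free_module :=
  free_module_mulr v (ga_of K w).

Lemma free_actE v w x : free_act v w x = v x * ga_of K w.
Proof. by rewrite ffunE. Qed.

Fact free_act_linear w : linear (fun v => free_act v w).
Proof.
move=> k u v; apply/ffunP => x; rewrite free_actE.
rewrite [in LHS]ffunE [in LHS]ffunE [in RHS]ffunE [in RHS]ffunE.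
by rewrite !free_actE mulrDl scalerAl.
Qed.

Fact free_act1 v : free_act v 1%g = v.
Proof. by apply/ffunP => x; rewrite free_actE [LHS]mulr1. Qed.

Fact free_actM v w z : free_act v (w * z)%g = free_act (free_act v w) z.
Proof. by apply/ffunP => x; rewrite !free_actE ga_ofM mulrA. Qed.

Definition free_rep : representation K :=
  Representation free_act_linear free_act1 free_actM.

End FreeRepresentation.

Definition group_ker (G H : groupType) (f : {multiplicative G -> H}) : set G :=
  [set g | f g = 1%g].

Definition linear_ker (K : fieldType) (V W : lmodType K)
    (f : {linear V -> W}) : set V :=
  [set v | f v = 0].

Section RepresentationEquivalence.
Variable K : fieldType.

Definition rep_solutions (X Y : finType)
    (T1 : set (free_module K X Y)) (T2 : set (free_group Y))
    (R : representation K) :=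
  [set f : rep_hom (free_rep K X Y) R |
    T1 `<=` linear_ker (hom_space f) /\
    T2 `<=` group_ker (hom_group f)].

Definition rep_closure (X Y : finType)
    (T1 : set (free_module K X Y)) (T2 : set (free_group Y))
    (R : representation K) : set (free_module K X Y) * set (free_group Y) :=
  (\bigcap_(f in @rep_solutions X Y T1 T2 R) linear_ker (hom_space f),
   \bigcap_(f in @rep_solutions X Y T1 T2 R) group_ker (hom_group f)).

Definition geom_equiv (R1 R2 : representation K) : Prop :=
  forall (X Y : finType)
    (T1 : set (free_module K X Y)) (T2 : set (free_group Y)),
  rep_closure T1 T2 R1 = rep_closure T1 T2 R2.

Definition at_solutions (X Y : finType) (T : set (free_module K X Y))
    (R : representation K) :=
  [set f : rep_hom (free_rep K X Y) R | T `<=` linear_ker (hom_space f)].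

Definition at_closure (X Y : finType) (T : set (free_module K X Y))
    (R : representation K) : set (free_module K X Y) :=
  \bigcap_(f in @at_solutions X Y T R) linear_ker (hom_space f).

Definition at_equiv (R1 R2 : representation K) : Prop :=
  forall (X Y : finType) (T : set (free_module K X Y)),
  at_closure T R1 = at_closure T R2.

End RepresentationEquivalence.

Definition group_closure (Y : finType) (T : set (free_group Y))
    (G : groupType) : set (free_group Y) :=
  \bigcap_(f in [set f : {multiplicative free_group Y -> G}
                 | T `<=` group_ker f]) group_ker f.

Definition group_geom_equiv (G1 G2 : groupType) : Prop :=
  forall (Y : finType) (T : set (free_group Y)),
  group_closure T G1 = group_closure T G2.

(* Main.v *)
Require Import Defs.
From mathcomp Require Import all_boot all_algebra.
From HB Require Import structures.
From mathcomp Require Import all_fingroup.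
From mathcomp Require Import finmap.
From mathcomp.multinomials Require Import monalg.
From mathcomp Require Import boolp classical_sets.

(** Inflating a representation along a surjection [G -> H] does not change its
    action type closures, since homomorphisms out of a free group lift along
    surjections.  The regular representation of [C_2], inflated along the two
    surjections [C_2 * C_4 -> C_2] factoring through the two projections,
    therefore gives two action type equivalent representations of one and the
    same group.  They are distinguished by the quasi-identity
    [y^2 = 1 -> x o y = x]: it holds for the surjection through [C_4], which
    kills all involutions, and fails for the other one. *)

Set Implicit Arguments.
Unset Strict Implicit.
Unset Printing Implicit Defensive.

Import GRing.Theory.

Local Open Scope ring_scope.
Local Open Scope classical_set_scope.

Lemma multiplicative1 (G H : groupType) (f : {multiplicative G -> H}) :
  f 1%g = 1%g.
Proof. by apply: (mulgI (f 1%g)); rewrite -gmulfM !mulg1. Qed.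

Section LinearExtension.
Variables (K : fieldType) (T : choiceType) (V : lmodType K) (F : T -> V).
Implicit Type a : {malg K[T]}.

Definition malg_lift a : V := \sum_(t <- msupp a) a@_t *: F t.

Lemma malg_liftEw a (d : {fset T}) :
  (msupp a `<=` d)%fset -> malg_lift a = \sum_(t <- d) a@_t *: F t.
Proof.
move=> le; apply: big_fset_incl => // t _.
by move=> /mcoeff_outdom ->; rewrite scale0r.
Qed.

Lemma malg_lift_linear : linear malg_lift.
Proof.
move=> k a b; pose d := (msupp a `|` msupp b)%fset.
rewrite (@malg_liftEw _ d); last first.
  by apply: fsubset_trans (msuppD_le _ _) _; apply/fsetSU/msuppZ_le.
rewrite (@malg_liftEw a d) ?fsubsetUl // (@malg_liftEw b d) ?fsubsetUr //.
rewrite scaler_sumr -big_split; apply: eq_bigr => t _ /=.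
by rewrite mcoeffD mcoeffZ scalerDl scalerA.
Qed.

HB.instance Definition _ :=
  GRing.isLinear.Build K {malg K[T]} V _ malg_lift malg_lift_linear.

Lemma malg_liftU k t : malg_lift << k *g t >> = k *: F t.
Proof. by rewrite (malg_liftEw msuppU_le) big_seq_fset1 mcoeffUU. Qed.

End LinearExtension.

Section RepAction.
Variables (K : fieldType) (R : representation K).

Lemma rep_actZ k (v : R) g : rep_act (k *: v) g = k *: rep_act v g.
Proof. by rewrite (GRing.scalable_linear (rep_act_linear g)). Qed.

Lemma rep_act_sum I (r : seq I) (F : I -> R) g :
  rep_act (\sum_(i <- r) F i) g = \sum_(i <- r) rep_act (F i) g.
Proof.
have act0 : rep_act (0 : R) g = 0 by rewrite -[in LHS](scale0r (0 : R)) rep_actZ scale0r.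
have actD : {morph (fun v : R => rep_act v g) : u v / u + v}.
  by move=> u v; rewrite -[u]scale1r rep_act_linear !scale1r.
exact: (big_morph _ actD act0).
Qed.

End RepAction.

Section FreeRepresentationLift.
Variables (K : fieldType) (X Y : finType) (R : representation K).
Variables (e : X -> R) (b : {multiplicative free_group Y -> rep_group R}).

Definition free_rep_lift (v : free_module K X Y) : R :=
  \sum_x malg_lift (fun w => rep_act (e x) (b w)) (v x).

Lemma free_rep_lift_linear : linear free_rep_lift.
Proof.
move=> k u v; rewrite scaler_sumr -big_split; apply: eq_bigr => x _ /=.
by rewrite [in LHS]ffunE [in LHS]ffunE linearP.
Qed.

HB.instance Definition _ :=
  GRing.isLinear.Build K (free_module K X Y) R _ free_rep_lift
    free_rep_lift_linear.

(** Both sides are linear in [a], which reduces the claim to basis elements, where [b] is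
    multiplicative. *)
Lemma malg_lift_act (v : R) (a : group_algebra K (free_group Y)) w :
  malg_lift (fun z => rep_act v (b z)) (a * ga_of K w) =
  rep_act (malg_lift (fun z => rep_act v (b z)) a) (b w).
Proof.
rewrite [a]monalgE -[_ * _]/(ga_mul _ _) ga_mul_suml.
rewrite !linear_sum rep_act_sum; apply: eq_bigr => z _.
by rewrite ga_mulUU mulr1 /= !malg_liftU gmulfM rep_actM rep_actZ.
Qed.

Lemma free_rep_lift_act (v : free_rep K X Y) w :
  free_rep_lift (rep_act v w) = rep_act (free_rep_lift v) (b w).
Proof.
rewrite /free_rep_lift rep_act_sum.
by apply: eq_bigr => x _; rewrite free_actE malg_lift_act.
Qed.

(** The universal property of [free_rep]: [e] and [b] can be prescribed independently. *)
Lemma free_rep_hom : exists f : rep_hom (free_rep K X Y) R,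
  hom_group f = b /\
  forall x, hom_space f [ffun z => if z == x then 1 else 0] = e x.
Proof.
exists (@RepHom K (free_rep K X Y) R free_rep_lift b free_rep_lift_act).
split=> //= x; rewrite /free_rep_lift (bigD1 x) //= big1 => [|z /negPf zx].
  by rewrite addr0 ffunE eqxx malg_liftU scale1r multiplicative1 rep_act1.
by rewrite ffunE zx linear0.
Qed.

End FreeRepresentationLift.

Section Inflation.
Variables (K : fieldType) (R : representation K) (G : groupType).
Variable p : {multiplicative G -> rep_group R}.

Definition inflation : representation K :=
  @Representation K R G (fun v g => rep_act v (p g))
    (fun g => rep_act_linear (p g))
    (fun v => etrans (congr1 _ (multiplicative1 p)) (rep_act1 v))
    (fun v g h => etrans (congr1 _ (@gmulfM _ _ p g h)) (rep_actM v (p g) (p h))).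

(** Action type closures see only the linear parts of homomorphisms, so it is enough that the same
    linear parts occur for [inflation] and [R], which share their space. *)
Lemma inflation_at_equiv :
  (forall h, exists g, p g = h) -> at_equiv inflation R.
Proof.
move=> p_surj X Y T; apply/seteqP; split=> v Tv f Tf.
  (* Arbitrary preimages of the images of the free generators extend, by freeness, to a lift [b] of
     [hom_group f] along [p]. *)
  have [s sE] := choice (fun y : Y => p_surj (hom_group f (fg_gen y))).
  have [b bE] := free_group_lift s.
  have pbE : p \o b =1 hom_group f.
    by apply: (@free_group_ext _ _ (p \o b)) => y; rewrite /= bE sE.
  have act u w : hom_space f (rep_act u w) =
      @rep_act _ inflation (hom_space f u) (b w).
    by rewrite hom_act -pbE.
  exact: (Tv (@RepHom K _ inflation (hom_space f) b act)).
exact: (Tv (@RepHom K _ R (hom_space f) (p \o hom_group f) (hom_act f))).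
Qed.

End Inflation.

Section RegularRepresentation.
Variables (K : fieldType) (H : finGroupType).

(** Left translation of the argument makes this a right action: the delta function at [a] goes to
    the one at [g^-1 * a]. *)
Definition regular_act (v : {ffun H -> K^o}) (g : H) : {ffun H -> K^o} :=
  [ffun h => v (g * h)%g].

Fact regular_act_linear g : linear (regular_act^~ g).
Proof. by move=> k u v; apply/ffunP => h; rewrite !ffunE. Qed.

Fact regular_act1 v : regular_act v 1%g = v.
Proof. by apply/ffunP => h; rewrite ffunE mul1g. Qed.

Fact regular_actM v g h :
  regular_act v (g * h)%g = regular_act (regular_act v g) h.
Proof. by apply/ffunP => k; rewrite !ffunE mulgA. Qed.

Definition regular_rep : representation K :=
  Representation regular_act_linear regular_act1 regular_actM.

Lemma regular_rep_faithful g :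
  (forall v : regular_rep, rep_act v g = v) -> g = 1%g.
Proof.
(* The delta function at the identity, moved by [g], keeps its value at [1] only if [g = 1]. *)
move=> /(_ [ffun h => (h == 1%g)%:R]) /ffunP /(_ 1%g).
rewrite !ffunE mulg1 eqxx; case: eqP => // _ /eqP.
by rewrite eq_sym oner_eq0.
Qed.

End RegularRepresentation.

Lemma at_equiv_sym K (R1 R2 : representation K) :
  at_equiv R1 R2 -> at_equiv R2 R1.
Proof. by move=> e X Y T. Qed.

Lemma at_equiv_trans K (R1 R2 R3 : representation K) :
  at_equiv R1 R2 -> at_equiv R2 R3 -> at_equiv R1 R3.
Proof. by move=> e12 e23 X Y T; rewrite e12. Qed.

Definition involutions_act_trivially K (R : representation K) : Prop :=
  forall g : rep_group R, (g * g = 1)%g -> forall v : R, rep_act v g = v.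

(** With one generator of each sort, the quasi-identity says that [x o y - x] lies in the closure of
    the empty set and [y^2]. *)
Lemma geom_equiv_involutions K (R1 R2 : representation K) :
  geom_equiv R1 R2 ->
  involutions_act_trivially R1 -> involutions_act_trivially R2.
Proof.
move=> R12 triv1 g gg v; pose y := fg_gen tt; pose x : free_rep K unit unit :=
  [ffun z => if z == tt then 1 else 0].
pose T2 : set (free_group unit) := [set (y * y)%g].
have /(congr1 fst) /= cl := R12 unit unit set0 T2.
have [b bE] := free_group_lift (fun _ : unit => g).
have [f [fb /(_ tt) fx]] := free_rep_hom (fun _ : unit => v) b.
have : (\bigcap_(h in @rep_solutions _ unit unit set0 T2 R1) linear_ker (hom_space h))
    (rep_act x y - x).
  move=> h [_ /(_ _ (erefl _)) hyy]; rewrite /linear_ker /= linearB hom_act.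
  by rewrite triv1 ?subrr // -gmulfM.
have fy : hom_group f y = g by rewrite fb bE.
(* Since [f] sends [x] to [v] and [y] to [g], membership in the closure for [R2] yields that [g]
   fixes [v]. *)
rewrite cl => /(_ f); rewrite /linear_ker /= linearB hom_act fx fy => ker.
apply/eqP; rewrite -subr_eq0; apply/eqP/ker; split=> // _ ->.
by rewrite /group_ker /= gmulfM fy.
Qed.

(** The group law on these ordinals is addition modulo 4 and modulo 2, so this is the quotient map
    from C_4 to C_2. *)
Definition red_4_2 (k : 'I_4) : 'I_2 := inZp k.

Fact red_4_2M : {morph red_4_2 : k l / (k * l)%g}.
Proof. by move=> k l; apply/val_inj; rewrite /= modn_dvdm // modnDm. Qed.

HB.instance Definition _ :=
  monoid.isMultiplicative.Build _ _ red_4_2 red_4_2M.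

Theorem theorem3p1 (K : fieldType) :
  exists R1 R2 : representation K,
    [/\ at_equiv R1 R2,
        group_geom_equiv (rep_group R1) (rep_group R2)
      & ~ geom_equiv R1 R2].
Proof.
pose G : groupType := ('I_2 * 'I_4)%type.
pose p1 : {multiplicative G -> 'I_2} := red_4_2 \o snd.
pose p2 : {multiplicative G -> 'I_2} := fst.
pose R := regular_rep K 'I_2.
exists (@inflation K R G p1), (@inflation K R G p2); split=> //.
- apply: (@at_equiv_trans _ _ R); last apply: at_equiv_sym;
    apply: inflation_at_equiv => h; have lt_h2 : (h < 2)%N := ltn_ord h.
    exists (1%g, inord h); apply/val_inj.
    by rewrite /= inordK ?modn_small // (ltn_trans lt_h2).
  by exists (h, 1%g).
move=> /geom_equiv_involutions triv.
have : involutions_act_trivially (@inflation K R G p1).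
  (* Modulo 4, [k + k = 0] leaves only 0 and 2, both even, so [p1] sends the element to the
     identity. *)
  move=> [i k] [_ kk] v /=; rewrite -[RHS]regular_act1; congr regular_act.
  by apply/val_inj; case: k kk => [[|[|[|[|]]]]].
(* This involution is mapped by [p2] to the generator of C_2, which acts nontrivially by
   faithfulness. *)
move=> /triv /(_ (inord 1, 1)%g) h.
suff : (inord 1 : 'I_2) = 1%g by move/(congr1 val); rewrite /= inordK.
apply: (@regular_rep_faithful K); apply: h.
by congr pair; apply/val_inj; rewrite /= ?inordK.
Qed.
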